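(* Let $X$ be a Tychonoff space and let $\aleph_\alpha\geq\aleph_1$ be a cardinal. Then $C^*(X)$ is closed in $C_{\aleph_\alpha}(X)$. Hence $C^*(X)$ is dense in $C_{\aleph_\alpha}(X)$ if and only if $X$ is pseudocompact.
   Context: Tychonoff means completely regular and Hausdorff. $C(X)$ is the set of all real-valued continuous functions on $X$ and $C^*(X)$ is the set of all bounded members of $C(X)$; $X$ is pseudocompact if $C(X)=C^*(X)$. For an infinite cardinal $\aleph_\alpha$, $\mathcal{A}_{\aleph_\alpha}=\{A\subseteq X: |A|<\aleph_\alpha\}$. For $f\in C(X)$, $A\in\mathcal{A}_{\aleph_\alpha}$ and real $\epsilon>0$ put $B(f,A,\epsilon)=\{g\in C(X): \sup_{x\in A}|f(x)-g(x)|<\epsilon\}$ (equal to $C(X)$ when $A=\emptyset$). The sets $B(f,A,\epsilon)$ form a base of a topology on $C(X)$; $C_{\aleph_\alpha}(X)$ denotes $C(X)$ with this topology. *)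

(* Defs.v *)
From HB Require Import structures.
From mathcomp Require Import all_boot all_order all_algebra.
From mathcomp Require Import all_classical all_reals all_analysis.

Set Implicit Arguments.
Unset Strict Implicit.
Unset Printing Implicit Defensive.

Import Order.TTheory GRing.Theory Num.Theory.
Import numFieldNormedType.Exports.

Local Open Scope classical_set_scope.
Local Open Scope card_scope.
Local Open Scope ring_scope.

Definition card_lt {T U : Type} (A : set T) (B : set U) : Prop :=
  A #<= B /\ ~ (B #<= A).

(* A cardinal is represented by a type of that cardinality; by the axiom of
   choice, every infinite cardinal is an aleph. *)
Record infinite_cardinal := InfiniteCardinal {
  cardinal_carrier :> Type;
  cardinal_infinite : infinite_set [set: cardinal_carrier] }.

(* aleph_1 is the successor of aleph_0, the cardinal of nat. *)
Definition aleph1_le (kappa : infinite_cardinal) : Prop :=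
  card_lt [set: nat] [set: kappa].

Section cardinal_sums.

Let card_le_rel {T U : Type} (A : set T) (B : set U) (G : T -> U -> Prop) :
  (forall x, A x -> exists2 y, B y & G x y) ->
  (forall x x' y, A x -> A x' -> G x y -> G x' y -> x = x') -> A #<= B.
Proof.
move=> tot inj.
have tot' (x : A) : exists y : B, G (\val x) (\val y).
  by case: (tot _ (set_valP x)) => y By Gxy; exists (SigSub (mem_set By)).
have [f fG] := choice tot'.
apply/card_leP/injfunPex; exists f => // x y _ _ fxy.
apply/val_inj/(inj _ _ (\val (f x)));
  [exact: set_valP|exact: set_valP|exact: fG|].
by rewrite fxy; exact: fG.
Qed.

Let card_le_seq {T : Type} (A : set T) : infinite_set A ->
  exists2 s : nat -> T, (forall n, A (s n)) & injective s.
Proof.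
move=> /infiniteP /card_leP/injfunPex[f _ finj].
pose n' n : [set: nat] := SigSub (mem_set (I : [set: nat] n)).
exists (fun n => \val (f (n' n))) => [n|n m /val_inj fnm];
  first exact: set_valP.
by have /(congr1 \val) := finj _ _ (mem_set I) (mem_set I) fnm.
Qed.

Let card_le_total {T U : Type} (A : set T) (B : set U) : A #<= B \/ B #<= A.
Proof.
pose P (G : set (T * U)) := G `<=` A `*` B /\
  forall p q, G p -> G q -> p.1 = q.1 \/ p.2 = q.2 -> p = q.
have [|G [[GAB Ginj] Gmax]] := @Zorn_bigcup _ P.
  move=> F FP totF; split=> [p [G /FP[+ _] Gp]|]; first exact.
  move=> p q [G FG Gp] [H FH Hq]; case: (totF _ _ FG FH) => [GH|HG].
    by apply: (FP _ FH).2 => //; exact: GH.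
  by apply: (FP _ FG).2 => //; exact: HG.
have [domG|] := pselect (forall x, A x -> exists y, G (x, y)).
  left; apply: (@card_le_rel _ _ A B (fun x y => G (x, y))) =>
    [x /domG[y Gxy]|].
    by exists y => //; have [] := GAB _ Gxy.
  by move=> x x' y _ _ Gx Gx'; case: (Ginj _ _ Gx Gx' (or_intror erefl)).
move=> /existsNP[x /not_implyP[Ax nGx]].
right; apply: (@card_le_rel _ _ B A (fun y x => G (x, y))) => [y By|];
  last first.
  by move=> y y' z _ _ Gx Gx'; case: (Ginj _ _ Gx Gx' (or_introl erefl)).
apply: contrapT => nGy; apply: (Gmax (G `|` [set (x, y)])).
  split; first by move=> p; left.
  by move=> /(_ (x, y) (or_intror erefl)) Gxy; apply: nGx; exists y.
split=> [p [/GAB//|->//]|p q [Gp|->] [Gq|->]//=].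
- exact: Ginj.
- case: p Gp => a b Gab /= [ax|bY]; first by case: nGx; exists b; rewrite -ax.
  by case: nGy; exists a; [have [] := GAB _ Gab|rewrite -bY].
- case: q Gq => a b Gab /= [ax|bY]; first by case: nGx; exists b; rewrite ax.
  by case: nGy; exists a; [have [] := GAB _ Gab|rewrite bY].
Qed.

Let card_setU_le {T U : Type} (A B : set T) (C : set U) : A #<= C -> B #<= C ->
  A `|` B #<= C `*` [set: bool].
Proof.
move=> /card_leP/injfunPex[f _ finj] /card_leP/injfunPex[g _ ginj].
pose G x (p : U * bool) :=
  (p.2 /\ exists a : A, \val a = x /\ \val (f a) = p.1) \/
  (~~ p.2 /\ exists b : B, \val b = x /\ \val (g b) = p.1).
apply: (@card_le_rel _ _ _ _ G) => [x [Ax|Bx]|x x' [y []] _ _].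
- pose a : A := SigSub (mem_set Ax).
  by exists (\val (f a), true);
    [split=> //; exact: set_valP|left; split=> //; exists a].
- pose b : B := SigSub (mem_set Bx).
  by exists (\val (g b), false);
    [split=> //; exact: set_valP|right; split=> //; exists b].
- move=> [[_ [a [<- /= fa]]]|[]//] [[_ [a' [<- /= fa']]]|[]//].
  by congr (\val _); apply: finj; rewrite ?inE//;
    exact: val_inj (etrans fa (esym fa')).
- move=> [[]//|[_ [b [<- /= gb]]]] [[]//|[_ [b' [<- /= gb']]]].
  by congr (\val _); apply: ginj; rewrite ?inE//;
    exact: val_inj (etrans gb (esym gb')).
Qed.

Let card_setX_bool {T : Type} (A : set T) : infinite_set A ->
  A `*` [set: bool] #<= A.
Proof.
move=> Ainf.
pose D : set (nat -> T) := [set s | injective s /\ range s `<=` A].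
have [E [ED tE Emax]] :=
  @ex_maximal_disjoint_subcollection _ _ (fun s => range s) D.
pose V := \bigcup_(s in E) range s.
have VA : V `<=` A by move=> x [s /ED[_ sA] /sA].
have finAV : finite_set (A `\` V).
  apply: contrapT => /card_le_seq[s sAV sinj].
  have sV n t m : E t -> s n = t m -> False.
    by move=> Et snm; case: (sAV n) => _; apply; exists t => //; exists m.
  apply: (Emax (E `|` [set s])).
  - split; first by move=> t; left.
    by move=> /(_ s (or_intror erefl)) Es; apply: (sV 0 s 0) Es erefl.
  - move=> t [/ED//|->]; split=> // _ [n _ <-]; by case: (sAV n).
  - move=> t u [Et|->] [Eu|->] //.
    + exact: tE.
    + by case=> x [[n _ <-] [m _ snm]]; case: (sV _ _ _ Et snm).
    + by case=> x [[n _ <-] [m _ /esym snm]]; case: (sV _ _ _ Eu snm).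
have V2 : V `*` [set: bool] #<= V.
  pose G (p : T * bool) y :=
    exists s n, [/\ E s, p.1 = s n & y = s (n.*2 + p.2)%N].
  apply: (@card_le_rel _ _ _ _ G) => [[x b] [/= [s Es [n _ <-]] _]|].
    by exists (s (n.*2 + b)%N); [exists s|exists s, n].
  move=> [x b] [x' b'] y _ _ [s [n [/= Es -> ->]]] [t [m [/= Et -> stE]]].
  have st : s = t.
    apply: tE => //; exists (s (n.*2 + b)%N); split=> /=; first by eexists.
    by rewrite stE; eexists.
  move: stE; rewrite -st => /(ED _ Es).1 nm.
  have bb : b = b'.
    by move: (congr1 odd nm); rewrite !oddD !odd_double /= !oddb.
  by move: nm; rewrite bb => /addIn /double_inj ->.
have Vinf : infinite_set V.
  move=> finV; apply: Ainf; rewrite -(setDUK VA); rewrite finite_setU; by split.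
have AV : A #<= V.
  rewrite -(setDUK VA); apply: card_le_trans V2; apply: card_setU_le.
    exact: card_lexx.
  have [//|/card_le_finite fin] := card_le_total (A `\` V) V.
  by case: Vinf; exact: fin.
apply: card_le_trans (subset_card_le VA).
apply: (card_le_trans _ V2).
move: AV => /card_leP/injfunPex[f _ finj].
pose G (p : T * bool) (q : T * bool) :=
  p.2 = q.2 /\ exists a : A, \val a = p.1 /\ \val (f a) = q.1.
apply: (@card_le_rel _ _ _ _ G) => [[x b] [/= Ax _]|].
  pose a : A := SigSub (mem_set Ax).
  by exists (\val (f a), b); [split=> //; exact: set_valP|split=> //; exists a].
move=> [x b] [x' b'] [y c] _ _ [/= -> [a [<- fa]]] [/= -> [a' [<- fa']]].
by congr (\val _, _); apply: finj; rewrite ?inE//;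
    exact: val_inj (etrans fa (esym fa')).
Qed.

Lemma card_lt_setU {T : Type} (A B : set T) (kappa : infinite_cardinal) :
  card_lt A [set: kappa] -> card_lt B [set: kappa] ->
  card_lt (A `|` B) [set: kappa].
Proof.
move=> Ak Bk; suff nAB : ~ ([set: kappa] #<= A `|` B).
  by split=> //; case: (card_le_total (A `|` B) [set: kappa]).
wlog BA : A B Ak Bk / B #<= A.
  by case: (card_le_total A B) => [AB|BA]; [rewrite setUC|]; exact.
have [finA|infA] := pselect (finite_set A).
  move=> /card_le_finite kAB; apply: (@cardinal_infinite kappa); apply: kAB.
  by rewrite finite_setU; split=> //; exact: card_le_finite finA.
move=> kAB; apply: Ak.2; apply: card_le_trans kAB _.
by apply: card_le_trans (card_setX_bool infA);
  apply: card_setU_le; rewrite ?card_lexx.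
Qed.

Lemma card_lt0 {T : Type} (kappa : infinite_cardinal) :
  card_lt (@set0 T) [set: kappa].
Proof.
split=> [|/card_le_finite fin]; first exact: card_ge0.
by apply: (@cardinal_infinite kappa); apply: fin; exact: finite_set0.
Qed.

End cardinal_sums.

Definition tychonoff_space (X : topologicalType) : Prop :=
  completely_regular_space X /\ hausdorff_space X.

Section function_spaces.
Context (R : realType) (X : topologicalType).

(* C^*(X) *)
Definition bounded_continuous : set (continuousType X R) :=
  [set f | bounded_fun (f : X -> R)].

Definition pseudocompact : Prop := bounded_continuous = setT.

(* B(f, A, eps); the supremum is taken in the extended reals, so that it is
   -oo for A empty and +oo when f - g is unbounded on A. *)
Definition unif_ball (f : continuousType X R) (A : set X) (eps : R) :
    set (continuousType X R) :=
  [set g | (ereal_sup [set `|f x - g x|%:E | x in A] < eps%:E)%E].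

Definition unif_base (kappa : infinite_cardinal) :
    set (set (continuousType X R)) :=
  [set B | exists f A eps,
    [/\ card_lt A [set: kappa], 0 < eps & B = unif_ball f A eps]].

Lemma unif_ball_center f A eps : 0 < eps -> unif_ball f A eps f.
Proof.
move=> eps0; rewrite /unif_ball /=.
apply: (@le_lt_trans _ _ 0%E); last by rewrite lte_fin.
by apply: ge_ereal_sup => _ [x _ <-]; rewrite subrr normr0.
Qed.

Lemma unif_ball_sub f A eps g : unif_ball f A eps g ->
  exists2 d, 0 < d & forall A', A `<=` A' ->
    unif_ball g A' d `<=` unif_ball f A eps.
Proof.
rewrite /unif_ball /= => fg.
have [d [d0 fgd]] : exists d, 0 < d /\
    (ereal_sup [set `|f x - g x|%:E | x in A] <= (eps - d)%:E)%E.
  case: (ereal_sup _) fg => [s|//|_].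
  - rewrite lte_fin => s_eps; exists (eps - s); rewrite subr_gt0; split=> //.
    by rewrite opprB addrC subrK.
  - by exists 1; split=> //; rewrite leNye.
exists d => // A' AA' h /= gh.
have [e [ed he]] : exists e, e < d /\
    (ereal_sup [set `|g x - h x|%:E | x in A'] <= e%:E)%E.
  case: (ereal_sup _) gh => [s|//|_].
  - by rewrite lte_fin => sd; exists s.
  - by exists 0; split=> //; rewrite leNye.
apply: (@le_lt_trans _ _ (eps - d + e)%:E); last first.
  by rewrite lte_fin -[ltRHS](subrK d) ltrD2l.
apply: ge_ereal_sup => _ [x Ax <-]; rewrite lee_fin.
rewrite -(subrKA (g x)); apply: (le_trans (ler_normD _ _)); apply: lerD.
  by rewrite -lee_fin; apply: le_trans fgd; apply: ereal_sup_ubound; exists x.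
rewrite -lee_fin; apply: le_trans he; apply: ereal_sup_ubound.
by exists x => //; exact: AA'.
Qed.

Lemma unif_ball_le f A eps eps' : eps <= eps' ->
  unif_ball f A eps `<=` unif_ball f A eps'.
Proof. by move=> ee g /= /lt_le_trans; apply; rewrite lee_fin. Qed.

Lemma unif_base_cover kappa : \bigcup_(B in unif_base kappa) B = setT.
Proof.
apply/seteqP; split=> // f _; exists (unif_ball f set0 1).
  by exists f, set0, 1; split=> //; exact: card_lt0.
exact: unif_ball_center.
Qed.

Lemma unif_base_join kappa B1 B2 g : unif_base kappa B1 -> unif_base kappa B2 ->
  B1 g -> B2 g -> exists B, [/\ unif_base kappa B, B g & B `<=` B1 `&` B2].
Proof.
move=> [f1 [A1 [e1 [A1k _ ->]]]] [f2 [A2 [e2 [A2k _ ->]]]].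
move=> /unif_ball_sub[d1 d1_gt0 sub1] /unif_ball_sub[d2 d2_gt0 sub2].
pose d := Num.min d1 d2.
have d_gt0 : 0 < d by rewrite lt_min d1_gt0.
exists (unif_ball g (A1 `|` A2) d); split.
- by exists g, (A1 `|` A2), d; split=> //; exact: card_lt_setU.
- exact: unif_ball_center.
- move=> h gh; split.
    by apply: (sub1 (A1 `|` A2));
      [left|apply: unif_ball_le gh; rewrite ge_min lexx].
  by apply: (sub2 (A1 `|` A2));
      [right|apply: unif_ball_le gh; rewrite ge_min lexx orbT].
Qed.

End function_spaces.

Arguments bounded_continuous : clear implicits.

(* C(X) with the topology having the sets B(f, A, eps), |A| < kappa, as base *)
Definition C_aleph (kappa : infinite_cardinal) (R : realType)
  (X : topologicalType) : Type := continuousType X R.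

HB.instance Definition _ kappa R X := Choice.on (C_aleph kappa R X).

HB.instance Definition _ kappa R X := @isBaseTopological.Build
  (C_aleph kappa R X) (set (C_aleph kappa R X)) (@unif_base R X kappa) id
  (@unif_base_cover R X kappa) (@unif_base_join R X kappa).

(* Main.v *)
(** If [f] is unbounded, choose [u n] with [n < |f (u n)|].  The countable set
    [A] of all [u n] has cardinality below [kappa], because [kappa] is
    uncountable, and every member of [B(f, A, 1)] is unbounded on [A]; so no
    bounded function lies in this neighbourhood of [f]. *)

Require Import Defs.
From mathcomp Require Import all_boot all_order all_algebra.
From mathcomp Require Import lra.
From mathcomp Require Import all_classical all_reals all_analysis.
Import Order.TTheory GRing.Theory Num.Theory.
Import numFieldNormedType.Exports.

Local Open Scope classical_set_scope.
Local Open Scope ring_scope.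

(** An injection of [kappa] into a countable set would make [kappa] itself countable, against
    [aleph1_le]. *)
Lemma card_lt_countable (T : Type) (A : set T) (kappa : infinite_cardinal) :
  aleph1_le kappa -> countable A -> card_lt A [set: kappa].
Proof.
move=> [nk kn] cA; split; first exact: card_le_trans cA nk.
by move=> kA; apply: kn; exact: card_le_trans kA cA.
Qed.

Lemma nbhs_unif_ball (kappa : infinite_cardinal) (R : realType)
    (X : topologicalType) (f : C_aleph kappa R X) (A : set X) (eps : R) :
  card_lt A [set: kappa] -> 0 < eps ->
  nbhs f (unif_ball f A eps : set (C_aleph kappa R X)).
Proof.
move=> Ak eps0; apply: open_nbhs_nbhs; split; last exact: unif_ball_center.
exists [set unif_ball f A eps]; last by rewrite bigcup_set1.
by move=> _ ->; exists f, A, eps.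
Qed.

Lemma unif_ball_lt (R : realType) (X : topologicalType)
    (f g : continuousType X R) (A : set X) (eps : R) (x : X) :
  unif_ball f A eps g -> A x -> `|f x - g x| < eps.
Proof.
move=> fg Ax; rewrite -lte_fin; apply: le_lt_trans fg.
by apply: ereal_sup_ubound; exists x.
Qed.

Lemma unbounded_seq (R : realType) (X : Type) (f : X -> R) :
  ~ bounded_fun f -> exists u : nat -> X, forall n, n%:R < `|f (u n)|.
Proof.
move=> nbf.
suff /choice[u fu] : forall n, exists x, n%:R < `|f x| by exists u.
move=> n.
(* If no [x] works for this [n], then [n%:R] is a threshold beyond which every [M] bounds [f], which
   is what [bounded_fun] asks for. *)
apply: contrapT => /forallNP fn; apply: nbf; exists n%:R.
split; first exact: num_real.
by move=> M nM x _; apply: le_trans (ltW nM); rewrite leNgt; apply/negP/fn.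
Qed.

Lemma closed_bounded_continuous (kappa : infinite_cardinal) (R : realType)
    (X : topologicalType) : aleph1_le kappa ->
  closed (bounded_continuous R X : set (C_aleph kappa R X)).
Proof.
move=> k1 f clf; apply: contrapT => /unbounded_seq[u fu].
have ck : card_lt (range u) [set: kappa].
  exact/card_lt_countable/card_image_le.
have [g [[M [_ gM]] /unif_ball_lt fg]] :=
  clf _ (nbhs_unif_ball _ _ _ f _ _ ck ltr01).
(* [|M| + 1] will bound [g] and the ball has radius 1, so [|f (u n)|] is at most [|M| + 2]; this [n]
   exceeds that, against [fu n]. *)
pose n := (Num.truncn (`|M| + 2)).+1.
have := fu n; apply/negP; rewrite -leNgt.
(* [gM] gives a bound only for numbers strictly above [M], which may be negative; [|M| + 1] is
   one. *)
have gn : `|(g : continuousType X R) (u n)| <= `|M| + 1.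
  by apply: gM => //; rewrite (le_lt_trans (ler_norm M))// ltrDl.
have fgn := fg (u n) (ex_intro2 _ _ n I erefl).
apply: (le_trans (y := `|M| + 2)); last exact/ltW/truncnS_gt.
by move: gn fgn; rewrite -lerBlDr; have := lerB_dist (f (u n)) (g (u n)); lra.
Qed.

Theorem mainTheorem2 (R : realType) (X : topologicalType)
    (kappa : infinite_cardinal) :
  tychonoff_space X -> aleph1_le kappa ->
  closed (bounded_continuous R X : set (C_aleph kappa R X)) /\
  (dense (bounded_continuous R X : set (C_aleph kappa R X)) <->
   pseudocompact R X).
Proof.
move=> _ k1; have clC := closed_bounded_continuous kappa R X k1.
split=> //; split=> [dC|pX].
  apply/seteqP; split=> // f _; apply: contrapT => nf.
  (* The complement of the closed set is open and contains [f], so density would put a bounded [g]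
     in it. *)
  by have [] := dC _ (ex_intro _ f nf) (closed_openC clC) => g [].
move=> O [f Of] _; exists f; split=> //.
by move: pX; rewrite /pseudocompact => ->.
Qed.
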